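(* Let $\nu \ge 2$, let $C \subset \mathbb{R}^n$ be a compact convex set and let $f: C^o \to \mathbb{R}$ be a $C^3$ function on the interior $C^o$ of $C$. For every interior point $x \in C^o$ and every non-zero direction $v$, let $I$ be the interval obtained by intersecting $C$ with the line $x + \mathbb{R} v$. Parameterize $I$ affinely by $t \in [-1,1]$, let $f_I: (-1,1) \to \mathbb{R}$ be the restriction of $f$ to $I$, and let $t_0 \in (-1,1)$ be the parameter value corresponding to the point $x$. Set $p = f_I'(t_0)$, $h = f_I''(t_0)$, $w = f_I'''(t_0)$ (derivatives with respect to $t$), and define $$\tilde p = (1-t_0^2)p - t_0,\qquad \tilde h = (1-t_0^2)^2h - 2t_0(1-t_0^2)p + t_0^2,$$ $$\tilde w = (1-t_0^2)^3w - 6t_0(1-t_0^2)^2h + 6t_0^2(1-t_0^2)p - 2t_0^3.$$ Then the following conditions are equivalent: (i) for all $x \in C^o$ and all non-zero directions $v$, the triple $(\tilde p,\tilde h,\tilde w)$ is an element of the set $P_{\nu}$; (ii) the function $f$ satisfies the barrier conditions with parameter $\nu$ on $C$.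
   Context: For $\nu\ge 2$ put $\gamma = \frac{\nu-2}{\sqrt{\nu-1}}$. Barrier conditions with parameter $\nu$ on $C$: a $C^3$ function $f: C^o\to\mathbb{R}$ satisfies them if (1) $f''(x) - f'(x)\otimes f'(x) \succ 0$ for all $x\in C^o$; (2) $\lim_{x\to\partial C} f(x) = +\infty$; (3) $|f'''(x)[v,v,v] - 6f''(x)[v,v]f'(x)[v] + 4(f'(x)[v])^3| \le 2\gamma\,(f''(x)[v,v] - (f'(x)[v])^2)^{3/2}$ for all $x\in C^o$ and all vectors $v\in\mathbb{R}^n$. The set $P_\nu \subset \mathbb{R}^3$ is the set of all $(x_1,x_2,x_3)$ with $x_2 \ge x_1^2$ such that for both choices of the sign $$\frac{\sqrt{x_2-x_1^2}}{\sqrt{\nu-1}} \le \pm x_1 + 1 \le \sqrt{\nu-1}\,\sqrt{x_2-x_1^2},$$ and $$|x_3 - 6x_2x_1 + 4x_1^3| \le 2\,\frac{\nu-2}{\sqrt{\nu-1}}\,(x_2-x_1^2)^{3/2}.$$ *)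

(* Defs.v *)
From HB Require Import structures.
From mathcomp Require Import all_boot all_order all_algebra.
From mathcomp Require Import all_classical all_reals all_analysis.

Set Implicit Arguments.
Unset Strict Implicit.
Unset Printing Implicit Defensive.

Import Order.TTheory GRing.Theory Num.Theory.
Import numFieldNormedType.Exports.

Local Open Scope classical_set_scope.
Local Open Scope ring_scope.

Section Differentials.
Variables (R : realType) (n : nat).
Implicit Types (U : set 'rV[R]_n) (f : 'rV[R]_n -> R) (x u v w : 'rV[R]_n).

(* A function on an open set U is represented by a total function whose values
   outside U are irrelevant: all notions below only depend on the germs of f at
   the points of U.  The differentials are iterated Frechet differentials,
   evaluated on vectors: f'(x)[v], f''(x)[u,v], f'''(x)[u,v,w]. *)
Definition D1 f x v : R := 'd f x v.
Definition D2 f x u v : R := 'd (fun y => D1 f y v) x u.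
Definition D3 f x u v w : R := 'd (fun y => D2 f y v w) x u.

(* f is of class C^k on the open set U.  As the dimension is finite, continuity
   of the differential for the operator norm is the same as continuity of all
   its evaluations. *)
Fixpoint C_on (k : nat) U f : Prop :=
  match k with
  | 0 => forall x, U x -> {for x, continuous f}
  | k'.+1 => (forall x, U x -> differentiable f x) /\
             (forall v, C_on k' U (fun x => D1 f x v))
  end.

(* Used for f''(x) - f'(x) (x) f'(x), which is symmetric for f of class C^2. *)
Definition posdef (B : 'rV[R]_n -> 'rV[R]_n -> R) : Prop :=
  forall v, v != 0 -> 0 < B v v.

End Differentials.

Section Barrier.
Variable R : realType.

Definition barrier_gamma (nu : R) : R := (nu - 2) / Num.sqrt (nu - 1).

(* The C^3 regularity of f is assumed separately.  The limit in the second
   condition is taken along points of the interior of C; in the third one, the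
   base of the real power is positive for v <> 0 by the first condition. *)
Definition barrier_conditions (n : nat) (nu : R) (C : set 'rV[R]_n)
    (f : 'rV[R]_n -> R) : Prop :=
  [/\ forall x, C° x ->
        posdef (fun u v => D2 f x u v - D1 f x u * D1 f x v),
      forall z, (closure C `\` C°) z -> f @ within C° (nbhs z) --> +oo_R
    & forall x, C° x -> forall v : 'rV[R]_n,
        `|D3 f x v v v - 6 * D2 f x v v * D1 f x v + 4 * D1 f x v ^+ 3|
        <= 2 * barrier_gamma nu *
           (D2 f x v v - D1 f x v ^+ 2) `^ (3 / 2)].

Definition P_set (nu : R) : set (R * R * R) :=
  [set p | let: (x1, x2, x3) := p in
    let s := Num.sqrt (x2 - x1 ^+ 2) in
    [/\ x1 ^+ 2 <= x2,
        s / Num.sqrt (nu - 1) <= x1 + 1 <= Num.sqrt (nu - 1) * s,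
        s / Num.sqrt (nu - 1) <= - x1 + 1 <= Num.sqrt (nu - 1) * s
      & `|x3 - 6 * x2 * x1 + 4 * x1 ^+ 3|
        <= 2 * ((nu - 2) / Num.sqrt (nu - 1)) * (x2 - x1 ^+ 2) `^ (3 / 2)]].

Definition tilde_p (t0 p : R) : R := (1 - t0 ^+ 2) * p - t0.

Definition tilde_h (t0 p h : R) : R :=
  (1 - t0 ^+ 2) ^+ 2 * h - 2 * t0 * (1 - t0 ^+ 2) * p + t0 ^+ 2.

Definition tilde_w (t0 p h w : R) : R :=
  (1 - t0 ^+ 2) ^+ 3 * w - 6 * t0 * (1 - t0 ^+ 2) ^+ 2 * h
  + 6 * t0 ^+ 2 * (1 - t0 ^+ 2) * p - 2 * t0 ^+ 3.

Definition line (n : nat) (x v : 'rV[R]_n) : set 'rV[R]_n :=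
  [set x + s *: v | s in [set: R]].

Definition affine_path (n : nat) (c d : 'rV[R]_n) (t : R) : 'rV[R]_n :=
  c + t *: d.

(* t |-> c + t d is an affine parameterization by [-1, 1] of the intersection
   of C with the line x + R v.  For C compact convex, x interior to C and
   v <> 0 there are exactly two of them, exchanged by t |-> - t. *)
Definition chord_param (n : nat) (C : set 'rV[R]_n) (x v c d : 'rV[R]_n) : Prop :=
  set_bij `[-1, 1] (C `&` line x v) (affine_path c d).

End Barrier.

(* Main.v *)
Require Import Defs.
From mathcomp Require Import all_boot all_order all_algebra.
From mathcomp Require Import all_classical all_reals all_analysis.
From mathcomp Require Import ring lra.
Import Order.TTheory GRing.Theory Num.Theory.
Import numFieldNormedType.Exports.
Local Open Scope classical_set_scope.
Local Open Scope ring_scope.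

(* Along a chord put p = f', h = f'', s = sqrt (h - p^2) and k = sqrt (nu - 1), so that
   gamma = k - 1/k.  The third barrier condition makes m = p + s/k satisfy m' >= m^2 and
   m = p + k s satisfy m' <= m^2.  With b the distance to the end of the chord, the first
   inequality forces m <= 1/b, as otherwise m would blow up inside the chord; the second
   one forces m >= 1/b, as otherwise p <= m would stay bounded up to the end, where f is
   infinite.  These bounds at both ends are the linear inequalities defining P_nu.
   Conversely, those inequalities give nu p >= 1/(1-t) - (nu-1)/(1+t) on the chord;
   integrated on chords issued from a fixed interior point, this shows that f tends to
   infinity at the boundary. *)

(** * Comparison lemmas and Riccati inequalities on an interval *)

Lemma is_derive_ge0_le (R : realType) (g g' : R -> R) (a b : R) : a <= b ->
  (forall s, a <= s <= b -> is_derive s 1 g (g' s)) ->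
  (forall s, a <= s <= b -> 0 <= g' s) -> g a <= g b.
Proof.
move=> ab dg g'0; have [||c cab E] := @MVT_segment R g g' a b ab.
- by move=> x; rewrite in_itv /= => /andP[/ltW ax /ltW xb]; apply: dg; rewrite ax.
- apply: derivable_within_continuous => x; rewrite in_itv /= => xab.
  by have := dg _ xab; case.
by rewrite -subr_ge0 E mulr_ge0 ?subr_ge0 // g'0 //; rewrite in_itv in cab.
Qed.

Lemma exists_left_near (R : realType) (a c : R) (P : set R) :
  a < c -> nbhs c P -> exists2 z, a <= z < c & P z.
Proof.
move=> ac /nbhs_ballP [e /= e0 He].
exists (Num.max a (c - e / 2)); first by case: (leP a (c - e/2)) => ?; lra.
by apply: He; rewrite -ball_normE /= ltr_norml; case: (leP a (c - e/2)) => ?; lra.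
Qed.

(** Let [c] be the infimum of the points where [g >= 0]. By continuity [g c >= 0], while [g < 0] on
    the left of [c]. If [g c > 0], then [g] is also positive just before [c]; if [g c = 0], the
    negative derivative makes it positive there. Both are absurd. *)
Lemma lt0_of_derive_lt0_at_zero (R : realType) (g g' : R -> R) (a b : R) : a <= b ->
  (forall s, a <= s <= b -> is_derive s 1 g (g' s)) ->
  (forall s, a <= s <= b -> g s = 0 -> g' s < 0) -> g a < 0 -> g b < 0.
Proof.
move=> ab dg g'0 ga; rewrite ltNge; apply/negP => gb.
pose S := [set s | a <= s <= b /\ 0 <= g s].
have Sb : S b by split => //; rewrite ab lexx.
have lbS : lbound S a by move=> s [/andP[]].
have hS : has_inf S by split; [exists b | exists a].
set c := inf S.
have ac : a <= c by apply: lb_le_inf => //; exists b.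
have cb : c <= b by apply: ge_inf => //; exists a.
have cab : a <= c <= b by rewrite ac.
have below : forall z, a <= z -> z < c -> g z < 0.
  move=> z az zc; rewrite ltNge; apply/negP => gz.
  suff : c <= z by rewrite leNgt zc.
  apply: ge_inf; first by exists a.
  by split => //; rewrite az (le_trans (ltW zc)).
(* Here [g z - g c] is [q z] times [z - c] with [q] continuous at [c], so the sign of [g' c]
   persists on a neighbourhood. *)
have /is_derive1_caratheodory [q [gE qcont qc]] := dg _ cab.
have gcont : {for c, continuous g}.
  by apply/differentiable_continuous/derivable1_diffP; have [] := dg _ cab.
have gc_ge0 : 0 <= g c.
  rewrite leNgt; apply/negP => gc.
  have gneg : nbhs c [set z | g z < 0] by apply: (cvgr_lt _ gcont _ gc).
  have /nbhs_ballP [e /= e0 He] := gneg.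
  have [s [/andP[as' sb] gs] sc] := inf_adherent e0 hS.
  have cs : c <= s by apply: ge_inf; [exists a | split => //; rewrite as'].
  have : g s < 0.
    apply: He; rewrite -ball_normE /= ltr_norml; rewrite -/c in sc; lra.
  by rewrite ltNge gs.
have ac' : a < c.
  by rewrite lt_neqAle ac andbT; apply/eqP => acE; move: ga; rewrite acE ltNge gc_ge0.
have [gc|gc] := eqVneq (g c) 0.
  have qc0 : q c < 0 by rewrite qc; apply: g'0.
  have [z /andP[az zc] qz] := exists_left_near _ _ _ _ ac' (cvgr_lt _ qcont _ qc0).
  have := below _ az zc; have := gE z; rewrite gc subr0 => ->.
  by rewrite nmulr_rlt0 // subr_gt0 ltNge (ltW zc).
have gc0 : 0 < g c by rewrite lt_neqAle eq_sym gc.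
have [z /andP[az zc] gz] := exists_left_near _ _ _ _ ac' (cvgr_gt _ gcont _ gc0).
by have := below _ az zc; rewrite ltNge (ltW gz).
Qed.

(** As long as [m > 0], the function [s + 1 / m] is nonincreasing. If [b * m 0 > 1], the time
    [s1 = 1 / m 0] lies before [b], and comparison with [s = 0] gives [1 / m s1 <= 0], although [m]
    is nondecreasing from a positive value. *)
Lemma riccati_super_bound (R : realType) (m m' : R -> R) (b : R) : 0 < b ->
  (forall s : R, 0 <= s < b -> is_derive s 1 m (m' s)) ->
  (forall s : R, 0 <= s < b -> m s ^+ 2 <= m' s) -> b * m 0 <= 1.
Proof.
move=> b0 dm m'm; rewrite leNgt; apply/negP => bm.
have m0 : 0 < m 0 by rewrite -(pmulr_rgt0 _ b0) (lt_trans _ bm).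
pose s1 := (m 0)^-1.
have s10 : 0 < s1 by rewrite invr_gt0.
have s1b : s1 < b by rewrite -[s1]mul1r ltr_pdivrMr.
have in_b : forall s t : R, t <= s1 -> 0 <= s <= t -> 0 <= s < b.
  by move=> s t ts1 /andP[-> st] /=; apply: le_lt_trans s1b; apply: le_trans ts1.
have m_gt0 : forall s : R, 0 <= s <= s1 -> 0 < m s.
  move=> s /andP[s0 ss1]; apply: lt_le_trans m0 _.
  apply: (@is_derive_ge0_le _ m m') => // t /in_b ts; first by apply: dm; apply: ts.
  by apply: le_trans (m'm _ (ts _)); rewrite ?sqr_ge0.
have ms1 : 0 < m s1 by apply: m_gt0; rewrite lexx ltW.
have im : 0 < (m s1)^-1 by rewrite invr_gt0.
have : - 0 - (m 0)^-1 <= - s1 - (m s1)^-1.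
  apply: (@is_derive_ge0_le _ (fun s => - s - (m s)^-1)
    (fun s => -1 + m' s / m s ^+ 2)) => [|s ss|s ss]; first exact: ltW.
    apply: is_derive_eq.
      apply: is_deriveB; apply: is_deriveV; first by rewrite gt_eqF // m_gt0.
      exact: dm (in_b _ _ (lexx _) ss).
    by rewrite scaleNr opprK mulrC.
  rewrite addrC subr_ge0 ler_pdivlMr ?exprn_gt0 ?m_gt0 // mul1r.
  exact: m'm (in_b _ _ (lexx _) ss).
by rewrite /s1 in im *; lra.
Qed.

(** If [b * m 0 < 1], then [m] stays below a function [1 / k] that is still bounded at [b]. So
    [p <= m] is bounded above, and [F] grows at most linearly on a bounded interval, against its
    unboundedness. *)
Lemma riccati_sub_bound (R : realType) (m m' F p : R -> R) (b : R) : 0 < b ->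
  (forall s : R, 0 <= s < b -> is_derive s 1 m (m' s)) ->
  (forall s : R, 0 <= s < b -> m' s <= m s ^+ 2) ->
  (forall s : R, 0 <= s < b -> is_derive s 1 F (p s)) ->
  (forall s : R, 0 <= s < b -> p s <= m s) ->
  (forall M, exists2 s : R, 0 <= s < b & M < F s) -> 1 <= b * m 0.
Proof.
move=> b0 dm m'm dF pm Funbdd; rewrite leNgt; apply/negP => bm.
(* The room between [b] and the blow-up time: any [B > b] serves when [m 0 <= 0], otherwise the
   midpoint of [b] and [1 / m 0]. *)
have [B bB Bm] : exists2 B, b < B & B * m 0 < 1.
  have [m0|m0] := leP (m 0) 0; first by exists (b + 1); nra.
  have b_lt : b < (m 0)^-1 by rewrite -[ltRHS]mul1r ltr_pdivlMr.
  have : (m 0)^-1 * m 0 = 1 by rewrite mulVf // gt_eqF.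
  exists ((b + (m 0)^-1) / 2); lra.
(* [k s = B - (1 + d) s] is positive on [0, b], and where [m = 1 / k] one has [(m k)' < 0]. *)
pose d : R := (B / b - 1) / 2.
have bd : d * b = (B - b) / 2 by rewrite /d; field; rewrite gt_eqF.
have d0 : 0 < d by rewrite -(pmulr_lgt0 _ b0) bd; lra.
pose k (s : R) : R := B - (1 + d) * s.
have k_ge (s : R) : 0 <= s < b -> (B - b) / 2 <= k s by move=> /andP[s0 sb]; rewrite /k; nra.
have dk (s : R) : is_derive s 1 k (- (1 + d)).
  by apply: is_derive_eq; rewrite /GRing.scale /=; ring.
have mk (s : R) : 0 <= s < b -> m s * k s - 1 < 0.
  move=> /andP[s0 sb].
  apply: (@lt0_of_derive_lt0_at_zero _ (fun s => m s * k s - 1)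
    (fun s => m s * - (1 + d) + k s * m' s) 0 s) => //.
  - move=> t /andP[t0 ts]; have dmt : is_derive t 1 m (m' t) by apply: dm; rewrite t0 (le_lt_trans ts).
    by apply: is_derive_eq; rewrite /GRing.scale /=; ring.
  - move=> t /andP[t0 ts] E.
    have tb : 0 <= t < b by rewrite t0 (le_lt_trans ts).
    have := k_ge _ tb; have := m'm _ tb; nra.
  - rewrite /k; lra.
have m_le (s : R) : 0 <= s < b -> m s <= ((B - b) / 2)^-1.
  move=> sb; have k0 := k_ge _ sb; have := mk _ sb => mks.
  have Bb : 0 < (B - b) / 2 by lra.
  apply: (@le_trans _ _ (k s)^-1); last by rewrite lef_pV2 // posrE; apply: lt_le_trans k0.
  by rewrite -[_^-1]mul1r ler_pdivlMr; [lra | apply: lt_le_trans k0].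
set M := ((B - b) / 2)^-1 in m_le.
have [s sb] := Funbdd (F 0 + M * b); apply/negP; rewrite -leNgt.
have /andP[s0 s_b] := sb.
have Mpos : 0 < M by rewrite invr_gt0; lra.
suff : M * 0 - F 0 <= M * s - F s by nra.
apply: (@is_derive_ge0_le _ (fun s => M * s - F s) (fun s => M - p s)) => // t /andP[t0 ts];
  have tb : 0 <= t < b by rewrite t0 (le_lt_trans ts).
  by have dFt := dF _ tb; apply: is_derive_eq; rewrite /GRing.scale /=; ring.
by rewrite subr_ge0 (le_trans (pm _ tb)) // m_le.
Qed.

(** * Riccati inequalities from the third barrier condition *)

Lemma powR3half (R : realType) (x : R) : 0 <= x -> x `^ (3 / 2) = Num.sqrt x ^+ 3.
Proof.
by move=> x0; rewrite mulrC powRrM powR12_sqrt // powR_mulrn // sqrtr_ge0.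
Qed.

(** The derivative is [h + a * (w - 2 p h) / (2 s)]. Substituting [h = s^2 + p^2] splits off the
    square of [p + a s] and leaves exactly the cubic expression of the third barrier condition. *)
Lemma is_derive_riccati (R : realType) (p h : R -> R) (w a t : R) :
  is_derive t 1 p (h t) -> is_derive t 1 h w -> p t ^+ 2 < h t ->
  let s u := Num.sqrt (h u - p u ^+ 2) in
  is_derive t 1 (fun u => p u + a * s u)
    ((p t + a * s t) ^+ 2 + (1 - a ^+ 2) * s t ^+ 2
     + a * ((w - 6 * h t * p t + 4 * p t ^+ 3) / (2 * s t))).
Proof.
move=> dp dh ph s.
have s_gt0 : 0 < s t by rewrite sqrtr_gt0 subr_gt0.
have s2 : s t ^+ 2 = h t - p t ^+ 2 by rewrite sqr_sqrtr // subr_ge0 ltW.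
have dhp : is_derive t 1 (fun u => h u - p u ^+ 2) (w - 2 * p t * h t).
  by apply: is_derive_eq; rewrite /GRing.scale /=; ring.
have ds : is_derive t 1 s ((2 * s t)^-1 * (w - 2 * p t * h t)).
  have hp0 : 0 < h t - p t ^+ 2 by rewrite subr_gt0.
  have D := is_derive1_sqrt hp0.
  have D2 := @is_derive1_comp _ Num.sqrt (fun u => h u - p u ^+ 2) t _ _ D dhp.
  exact: D2.
apply: is_derive_eq; rewrite /GRing.scale /=.
have -> : h t = s t ^+ 2 + p t ^+ 2 by rewrite s2 subrK.
by field; rewrite gt_eqF.
Qed.

(** The third condition reads [|e| <= (k - 1/k) s^2]. The remainder [(1 - a^2) s^2 + a e] is then
    nonnegative for [a = 1/k] and nonpositive for [a = k], so the two Riccati bounds apply to these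
    two choices of [p + a s]. *)
Lemma barrier_end_bounds (R : realType) (nu b : R) (F p h w : R -> R) :
  2 <= nu -> 0 < b ->
  (forall s : R, 0 <= s < b -> is_derive s 1 F (p s)) ->
  (forall s : R, 0 <= s < b -> is_derive s 1 p (h s)) ->
  (forall s : R, 0 <= s < b -> is_derive s 1 h (w s)) ->
  (forall s : R, 0 <= s < b -> p s ^+ 2 < h s) ->
  (forall s : R, 0 <= s < b -> `|w s - 6 * h s * p s + 4 * p s ^+ 3|
     <= 2 * barrier_gamma nu * (h s - p s ^+ 2) `^ (3 / 2)) ->
  (forall M, exists2 s : R, 0 <= s < b & M < F s) ->
  let sg := Num.sqrt (h 0 - p 0 ^+ 2) in
  b * (p 0 + sg / Num.sqrt (nu - 1)) <= 1 /\
  1 <= b * (p 0 + Num.sqrt (nu - 1) * sg).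
Proof.
move=> nu2 b0 dF dp dh ph bnd Funbdd sg0.
set k := Num.sqrt (nu - 1).
have k1 : 1 <= k by rewrite -[leLHS]sqrtr1 ler_sqrt; lra.
have k2 : k ^+ 2 = nu - 1 by rewrite sqr_sqrtr; lra.
have gE : barrier_gamma nu = k - k^-1.
  by rewrite /barrier_gamma -/k (_ : nu - 2 = k ^+ 2 - 1); [field; lra | lra].
pose sg u := Num.sqrt (h u - p u ^+ 2).
pose e u := (w u - 6 * h u * p u + 4 * p u ^+ 3) / (2 * sg u).
have e_le u : 0 <= u < b -> 0 < sg u /\ `|e u| <= (k - k^-1) * sg u ^+ 2.
  move=> ub; have sgu : 0 < sg u by rewrite sqrtr_gt0 subr_gt0 ph.
  split => //; have := bnd _ ub; rewrite gE powR3half ?subr_ge0 ?(ltW (ph _ ub)) //.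
  rewrite -/(sg u) /e normrM normfV (gtr0_norm (_ : 0 < 2 * sg u)); last lra.
  by rewrite ler_pdivrMr; lra.
have ki : 0 < k^-1 by rewrite invr_gt0; lra.
have kV : k * k^-1 = 1 by rewrite mulfV //; lra.
split.
  rewrite [sg0 / k]mulrC.
  apply: (@riccati_super_bound _ (fun u => p u + k^-1 * sg u) (fun u =>
    (p u + k^-1 * sg u) ^+ 2 + (1 - k^-1 ^+ 2) * sg u ^+ 2 + k^-1 * e u)) => // s sb.
    by apply: is_derive_riccati; [apply: dp | apply: dh | apply: ph].
  have [_] := e_le _ sb; rewrite ler_norml => /andP[e1 _].
  rewrite -addrA lerDl.
  have : k^-1 * (- ((k - k^-1) * sg s ^+ 2)) <= k^-1 * e s by rewrite ler_pM2l.
  have -> : k^-1 * (- ((k - k^-1) * sg s ^+ 2)) = - (1 - k^-1 ^+ 2) * sg s ^+ 2.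
    by field; lra.
  lra.
apply: (@riccati_sub_bound _ (fun u => p u + k * sg u) (fun u =>
    (p u + k * sg u) ^+ 2 + (1 - k ^+ 2) * sg u ^+ 2 + k * e u) F p) => // s sb.
- by apply: is_derive_riccati; [apply: dp | apply: dh | apply: ph].
- have [_] := e_le _ sb; rewrite ler_norml => /andP[_ e1].
  rewrite -addrA gerDl.
  have : k * e s <= k * ((k - k^-1) * sg s ^+ 2) by rewrite ler_pM2l; lra.
  have -> : k * ((k - k^-1) * sg s ^+ 2) = (k ^+ 2 - 1) * sg s ^+ 2 by field; lra.
  lra.
- by have [s0 _] := e_le _ sb; rewrite lerDl mulr_ge0; lra.
Qed.

(** * Convex sets and their interior *)

Lemma convex_set_comb (R : realType) (n : nat) (C : set 'rV[R]_n) x y (l : R) :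
  convex_set C -> C x -> C y -> 0 <= l <= 1 -> C (l *: x + (1 - l) *: y).
Proof.
move=> cC Cx Cy /andP[l0 l1].
by have := cC x y (Itv01 l0 l1); rewrite !inE => /(_ Cx Cy).
Qed.

(** The homothety of centre [y] and ratio [l] maps the ball around [x] onto the new ball; its
    inverse brings [z] back. *)
Lemma convex_ball_comb (R : realType) (n : nat) (C : set 'rV[R]_n) x y (r l : R) :
  convex_set C -> ball x r `<=` C -> C y -> 0 < l <= 1 ->
  ball (l *: x + (1 - l) *: y) (l * r) `<=` C.
Proof.
move=> cC xr Cy /andP[l0 l1] z; rewrite -ball_normE /= => zr.
have -> : z = l *: (l^-1 *: (z - (1 - l) *: y)) + (1 - l) *: y.
  by rewrite scalerA divff ?scale1r ?subrK // gt_eqF.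
apply: convex_set_comb => //; last by rewrite ltW.
apply: xr; rewrite -ball_normE /= -(ltr_pM2l l0) -[X in X * _](gtr0_norm l0) -normrZ.
by rewrite scalerBr scalerA divff ?scale1r ?gt_eqF // opprB addrA.
Qed.

Lemma convex_interior_comb (R : realType) (n : nat) (C : set 'rV[R]_n) x y (l : R) :
  convex_set C -> C° x -> C y -> 0 < l <= 1 -> C° (l *: x + (1 - l) *: y).
Proof.
move=> cC /nbhs_ballP[r /= r0 xr] Cy l01; apply/nbhs_ballP.
exists (l * r); first by rewrite /= mulr_gt0 //; case/andP: l01.
exact: convex_ball_comb.
Qed.

Lemma interior_ray (R : realType) (n : nat) (C : set 'rV[R]_n) (x v : 'rV[R]_n) :
  C° x -> exists2 e : R, 0 < e & C (x + e *: v).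
Proof.
(* The summand 1 in the denominator covers [v = 0]. *)
move=> /nbhs_ballP[r /= r0 xr]; exists (r / 2 / (1 + `|v|)).
  by rewrite !divr_gt0 // ltr_pwDl.
have v0 : 0 < 1 + `|v| by rewrite ltr_pwDl.
apply: xr; rewrite -ball_normE /= opprD addrA subrr sub0r normrN normrZ gtr0_norm; last first.
  by rewrite !divr_gt0.
by rewrite mulrAC ltr_pdivrMr //; have := normr_ge0 v; nra.
Qed.

(** * Chords of a convex set and their parameterizations *)

Section Chord.
Variables (R : realType) (n : nat) (C : set 'rV[R]_n) (x v c d : 'rV[R]_n).
Hypotheses (C_convex : convex_set C) (chord : chord_param C x v c d).

Lemma chord_mem t : -1 <= t <= 1 -> C (affine_path c d t).
Proof.
by case: chord => + _ _ => /(_ t) /=; rewrite in_itv /= => /[apply] -[].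
Qed.

(** The parameterization only speaks of [t] in [[-1, 1]], but every point of the path is an affine
    combination of its two ends, which lie on the line. *)
Lemma chord_line t : line x v (affine_path c d t).
Proof.
have [fun_ _ _] := chord.
have [_ [a _ Ea]] := fun_ 1 ltac:(by rewrite /= in_itv /=; lra).
have [_ [b _ Eb]] := fun_ (-1) ltac:(by rewrite /= in_itv /=; lra).
exists ((1 + t) / 2 * a + (1 - t) / 2 * b) => //.
have -> : x + ((1 + t) / 2 * a + (1 - t) / 2 * b) *: v
    = ((1 + t) / 2) *: (x + a *: v) + ((1 - t) / 2) *: (x + b *: v).
  by apply/rowP => i; rewrite !mxE; field.
by rewrite Ea Eb; apply/rowP => i; rewrite !mxE; field.
Qed.

Lemma chord_dir_neq0 : d != 0.
Proof.
apply/eqP => d0; have [_ inj_ _] := chord.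
have : (1 : R) = -1.
  by apply: inj_; rewrite ?inE /= ?in_itv /= /affine_path ?d0 ?scaler0 //; lra.
lra.
Qed.

(** Each point strictly inside the chord lies between the given interior point and one end of the
    chord, and is not that end. *)
Lemma chord_interior t0 t : C° (affine_path c d t0) -> -1 < t0 < 1 ->
  -1 < t < 1 -> C° (affine_path c d t).
Proof.
move=> Ct0 /andP[t0l t0u] /andP[tl tu].
have [le_t|lt_t] := leP t0 t.
  pose l := (1 - t) / (1 - t0).
  have -> : affine_path c d t = l *: affine_path c d t0 + (1 - l) *: affine_path c d 1.
    by apply/rowP => i; rewrite !mxE /l; field; lra.
  apply: convex_interior_comb => //; first by apply: chord_mem; lra.
  by rewrite divr_gt0 ?ler_pdivrMr ?mul1r; lra.
pose l := (1 + t) / (1 + t0).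
have -> : affine_path c d t = l *: affine_path c d t0 + (1 - l) *: affine_path c d (-1).
  by apply/rowP => i; rewrite !mxE /l; field; lra.
apply: convex_interior_comb => //; first by apply: chord_mem; lra.
by rewrite divr_gt0 ?ler_pdivrMr ?mul1r; lra.
Qed.

Lemma chord_mem_inv t : C (affine_path c d t) -> -1 <= t <= 1.
Proof.
move=> Ct; have [_ _ surj_] := chord.
have [|s] := surj_ (affine_path c d t); first by split => //; apply: chord_line.
rewrite /= in_itv /= => s1 /addrI /eqP.
rewrite -subr_eq0 -scalerBl scaler_eq0 (negPf chord_dir_neq0) orbF subr_eq0.
by move=> /eqP <-.
Qed.

(** From an interior point one could go on inside [C] to a parameter beyond 1. *)
Lemma chord_end_notin_interior : ~ C° (affine_path c d 1).
Proof.
move=> /(interior_ray _ _ _ _ d) [e e0].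
have -> : affine_path c d 1 + e *: d = affine_path c d (1 + e).
  by rewrite /affine_path -addrA -scalerDl.
by move=> /chord_mem_inv; lra.
Qed.

(** Transfers what is shown at the end [t = 1] to the end [t = -1]. *)
Lemma chord_rev : chord_param C x v c (- d).
Proof.
have [fun_ inj_ surj_] := chord.
have E t : affine_path c (- d) t = affine_path c d (- t).
  by rewrite /affine_path scalerN scaleNr.
split.
- by move=> t; rewrite /= in_itv /= => t1; rewrite E; apply: fun_; rewrite /= in_itv /=; lra.
- move=> s t; rewrite !inE /= !in_itv /= => s1 t1; rewrite !E => st.
  by apply: oppr_inj; apply: inj_ => //; rewrite inE /= in_itv /=; lra.
- move=> y /surj_ [t]; rewrite /= in_itv /= => t1 <-; exists (- t).
    by rewrite /= in_itv /=; lra.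
  by rewrite E opprK.
Qed.

End Chord.

Lemma line_shift (R : realType) (n : nat) (x v : 'rV[R]_n) (s : R) :
  line (x + s *: v) v = line x v.
Proof.
apply/seteqP; split=> _ [t _ <-].
  by exists (s + t); rewrite // scalerDl addrA.
by exists (t - s) => //; apply/rowP => i; rewrite !mxE; ring.
Qed.

(** [B] is the supremum of the parameters of points in [C]: boundedness makes it finite and
    closedness puts its point in [C]. *)
Lemma compact_ray_exit (R : realType) (n : nat) (C : set 'rV[R]_n) (x v : 'rV[R]_n) :
  compact C -> C° x -> v != 0 ->
  exists B : R, [/\ 0 < B, C (x + B *: v) & forall s, C (x + s *: v) -> s <= B].
Proof.
move=> cptC Cx v0.
pose S := [set s : R | C (x + s *: v)].
have C_closed : closed C by apply: compact_closed => //; apply: norm_hausdorff.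
have S_closed : closed S.
  apply: (@preimage_closed _ _ (fun s : R => x + s *: v)) => // s _.
  by apply: cvgD; [exact: cvg_cst | apply: cvgZr_tmp; exact: cvg_id].
have [M [Mreal CM]] := compact_bounded cptC.
have M1 : M < `|M| + 1 by rewrite (le_lt_trans (ler_norm _)) // ltrDl.
have vpos : 0 < `|v| by rewrite normr_gt0.
have S_ub : has_ubound S.
  exists ((`|M| + 1 + `|x|) / `|v|) => s /(CM _ M1) /= xs.
  rewrite ler_pdivlMr // (le_trans (ler_wpM2r _ (ler_norm s))) // -normrZ.
  by rewrite -[s *: v](addKr x) (le_trans (ler_normD _ _)) // normrN addrC lerD.
have [e e0 Ce] := interior_ray _ _ _ _ v Cx.
exists (sup S); split=> [||s Ss].
- by apply: lt_le_trans e0 _; apply: ub_le_sup.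
- by apply: S_closed; apply: closure_sup => //; exists e.
- exact: ub_le_sup.
Qed.

Lemma chord_param_exists (R : realType) (n : nat) (C : set 'rV[R]_n) (x v : 'rV[R]_n) :
  compact C -> convex_set C -> C° x -> v != 0 ->
  exists c t0 k, [/\ 0 < k, -1 < t0 < 1, chord_param C x v c (k *: v) &
    x = affine_path c (k *: v) t0].
Proof.
move=> cptC cC Cx v0.
have [B [B0 CB leB]] := compact_ray_exit _ _ _ _ _ cptC Cx v0.
have Nv0 : - v != 0 by rewrite oppr_eq0.
have [A [A0 CA leA]] := compact_ray_exit _ _ _ _ _ cptC Cx Nv0.
have CE s : C (x + s *: v) <-> - A <= s <= B.
  split=> [Cs|/andP[As sB]].
    by rewrite leB // lerNl leA // scalerN scaleNr opprK.
  pose l := (B - s) / (A + B).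
  rewrite (_ : x + s *: v = l *: (x + A *: - v) + (1 - l) *: (x + B *: v)).
    apply: convex_set_comb => //.
    by rewrite divr_ge0 ?ler_pdivrMr ?mul1r; lra.
  by apply/rowP => i; rewrite !mxE /l; field; lra.
(* The chord is the parameter interval [[-A, B]] along [v]; [k] is its half-length and [m] its
   midpoint. *)
pose k := (A + B) / 2; pose m := (B - A) / 2.
have k0 : 0 < k by rewrite /k; lra.
have pathE t : affine_path (x + m *: v) (k *: v) t = x + (m + t * k) *: v.
  by apply/rowP => i; rewrite !mxE; ring.
exists (x + m *: v), (- m / k), k; split => //.
- by rewrite ltr_pdivlMr ?ltr_pdivrMr // /m /k; lra.
- split.
  + move=> t; rewrite /= in_itv /= => t1; rewrite pathE; split; last by eexists.
    by apply/CE; rewrite /m /k; nra.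
  + move=> s t s1 t1; rewrite !pathE => /addrI /eqP.
    rewrite -subr_eq0 -scalerBl scaler_eq0 (negPf v0) orbF => st.
    by apply: (mulIf (lt0r_neq0 k0)); lra.
  + move=> y [Cy [s _ sE]]; exists ((s - m) / k); last first.
      by rewrite pathE -sE divfK ?gt_eqF // [m + _]addrC subrK.
    have /CE sAB : C (x + s *: v) by rewrite sE.
    by rewrite /= in_itv /= ler_pdivlMr ?ler_pdivrMr // /m /k; lra.
- by rewrite pathE divfK ?gt_eqF // subrr scale0r addr0.
Qed.

(** * Derivatives along affine paths and homogeneity of the differentials *)

Lemma is_derive_affine_path (R : realType) (n : nat) (g : 'rV[R]_n -> R)
    (c d : 'rV[R]_n) (t : R) :
  differentiable g (affine_path c d t) ->
  is_derive t 1 (g \o affine_path c d) (D1 g (affine_path c d t) d).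
Proof.
move=> dg.
have E : (fun h : R => h^-1 *: (((g \o affine_path c d) \o shift t) (h *: 1) - (g \o affine_path c d) t))
    = (fun h : R => h^-1 *: ((g \o shift (affine_path c d t)) (h *: d) - g (affine_path c d t))).
  apply/funext => h /=; congr (_ *: (g _ - _)).
  by apply/rowP => i; rewrite !mxE /GRing.scale /=; ring.
split; first by rewrite /derivable E; exact: diff_derivable.
by rewrite /derive E; exact: deriveE.
Qed.

Section HigherOrder.
Variables (R : realType) (n : nat) (C : set 'rV[R]_n) (f : 'rV[R]_n -> R).
Hypothesis f_C3 : C_on 3 C° f.

Lemma C3_differentiable x : C° x -> differentiable f x.
Proof. by case: f_C3 => + _; apply. Qed.

Lemma C3_differentiable_D1 x v : C° x -> differentiable (fun y => D1 f y v) x.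
Proof. by case: f_C3 => _ /(_ v) [+ _]; apply. Qed.

Lemma C3_differentiable_D2 x u v : C° x -> differentiable (fun y => D2 f y u v) x.
Proof. by case: f_C3 => _ /(_ v) [_ /(_ u) [+ _]]; apply. Qed.

Section Path.
Variables (c d : 'rV[R]_n) (t : R).
Hypothesis Ct : C° (affine_path c d t).

Lemma is_derive_path1 : is_derive t 1 (f \o affine_path c d) (D1 f (affine_path c d t) d).
Proof. exact/is_derive_affine_path/C3_differentiable. Qed.

Lemma is_derive_path2 : is_derive t 1 (fun s => D1 f (affine_path c d s) d)
  (D2 f (affine_path c d t) d d).
Proof. exact: (is_derive_affine_path _ _ _ _ _ _ (C3_differentiable_D1 _ d Ct)). Qed.

Lemma is_derive_path3 : is_derive t 1 (fun s => D2 f (affine_path c d s) d d)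
  (D3 f (affine_path c d t) d d d).
Proof. exact: (is_derive_affine_path _ _ _ _ _ _ (C3_differentiable_D2 _ d d Ct)). Qed.

(** A derivative of higher order at [t] depends on the lower ones near [t], and these are identified
    with differentials only where the path stays in the interior. *)
Lemma near_path_interior : \forall s \near t, C° (affine_path c d s).
Proof.
have path_cont : {for t, continuous (affine_path c d)}.
  by apply: cvgD; [exact: cvg_cst | apply: cvgZr_tmp; exact: cvg_id].
by apply: path_cont; apply: open_nbhs_nbhs; split => //; apply: open_interior.
Qed.

End Path.

Lemma derive1_path c d t : C° (affine_path c d t) ->
  (f \o affine_path c d)^`()%classic t = D1 f (affine_path c d t) d.
Proof. by move=> /is_derive_path1 df; rewrite derive1E derive_val. Qed.

Lemma derive1n2_path c d t : C° (affine_path c d t) ->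
  (f \o affine_path c d)^`(2)%classic t = D2 f (affine_path c d t) d d.
Proof.
move=> Ct; have df := is_derive_path2 _ _ _ Ct.
rewrite /derive1n /= derive1E -[RHS](@derive_val _ _ _ _ _ _ _ df).
by apply: near_eq_derive; near=> s; apply: derive1_path; near: s; exact: near_path_interior.
Unshelve. all: by end_near. Qed.

Lemma derive1n3_path c d t : C° (affine_path c d t) ->
  (f \o affine_path c d)^`(3)%classic t = D3 f (affine_path c d t) d d d.
Proof.
move=> Ct; have df := is_derive_path3 _ _ _ Ct.
rewrite /derive1n /= derive1E -[RHS](@derive_val _ _ _ _ _ _ _ df).
by apply: near_eq_derive; near=> s; apply: derive1n2_path; near: s; exact: near_path_interior.
Unshelve. all: by end_near. Qed.

Lemma D1Z x (k : R) v : D1 f x (k *: v) = k * D1 f x v.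
Proof. by rewrite /D1 linearZ. Qed.

Lemma D2Z x (k : R) v : C° x -> D2 f x (k *: v) (k *: v) = k ^+ 2 * D2 f x v v.
Proof.
move=> Cx; rewrite /D2 linearZ /= -!deriveE; [|exact: C3_differentiable_D1..].
rewrite (_ : (fun y => D1 f y (k *: v)) = k \*: (fun y => D1 f y v)); last first.
  by apply/funext => y; rewrite D1Z.
rewrite deriveZ; last exact/diff_derivable/C3_differentiable_D1.
by rewrite /GRing.scale /= mulrA.
Qed.

Lemma D3Z x (k : R) v : C° x ->
  D3 f x (k *: v) (k *: v) (k *: v) = k ^+ 3 * D3 f x v v v.
Proof.
move=> Cx; rewrite /D3 linearZ /= -!deriveE; [|exact: C3_differentiable_D2..].
(* The scaling rule [D2Z] holds only on the interior, hence only near [x]. *)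
rewrite (@near_eq_derive _ _ _ _ (k ^+ 2 \*: (fun y => D2 f y v v))).
  rewrite deriveZ; last exact/diff_derivable/C3_differentiable_D2.
  by rewrite /GRing.scale /= mulrA -exprS.
have : \forall y \near x, C° y by apply: open_nbhs_nbhs; split => //; apply: open_interior.
by apply: filterS => y Cy; rewrite D2Z.
Qed.

End HigherOrder.

(** * The set [P_set] in terms of the untransformed derivatives *)

Lemma powR3half_sqrM (R : realType) (u y : R) : 0 <= u -> 0 <= y ->
  (u ^+ 2 * y) `^ (3 / 2) = u ^+ 3 * y `^ (3 / 2).
Proof.
move=> u0 y0; rewrite !powR3half ?mulr_ge0 ?sqr_ge0 //.
by rewrite sqrtrM ?sqr_ge0 // sqrtr_sqr ger0_norm // exprMn.
Qed.

(** Both sides are homogeneous of degree 3 in [u]. This serves with [u = 1 - t^2] for the tilde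
    triple and with [u = k] for rescaled directions. *)
Lemma powR3half_boundZ (R : realType) (u e y g : R) : 0 < u -> 0 <= y ->
  (`|u ^+ 3 * e| <= g * (u ^+ 2 * y) `^ (3 / 2)) = (`|e| <= g * y `^ (3 / 2)).
Proof.
move=> u0 y0; rewrite powR3half_sqrM ?(ltW u0) // normrM gtr0_norm ?exprn_gt0 //.
by rewrite mulrCA ler_pM2l ?exprn_gt0.
Qed.

(* [t + 1] and [1 - t] are the distances from [t] to the ends of the chord: the
   tilde triple is the image of [(p, h, w)] under the projective change of
   variable for which [h - p^2] and [w - 6 h p + 4 p^3] are covariant. *)
Lemma P_set_tilde (R : realType) (nu t p h w : R) : 2 <= nu -> -1 < t < 1 ->
  let sg := Num.sqrt (h - p ^+ 2) in
  P_set nu (tilde_p t p, tilde_h t p h, tilde_w t p h w) <->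
  [/\ p ^+ 2 < h,
      (1 + t) * (- p + sg / Num.sqrt (nu - 1)) <= 1 /\
        1 <= (1 + t) * (- p + Num.sqrt (nu - 1) * sg),
      (1 - t) * (p + sg / Num.sqrt (nu - 1)) <= 1 /\
        1 <= (1 - t) * (p + Num.sqrt (nu - 1) * sg)
    & `|w - 6 * h * p + 4 * p ^+ 3| <= 2 * barrier_gamma nu * (h - p ^+ 2) `^ (3 / 2)].
Proof.
move=> nu2 /andP[tl tu] sg; rewrite /P_set /=.
set k := Num.sqrt (nu - 1).
have u0 : 0 < 1 - t ^+ 2 by nra.
have hE : tilde_h t p h - tilde_p t p ^+ 2 = (1 - t ^+ 2) ^+ 2 * (h - p ^+ 2).
  by rewrite /tilde_h /tilde_p; ring.
have wE : tilde_w t p h w - 6 * tilde_h t p h * tilde_p t p + 4 * tilde_p t p ^+ 3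
    = (1 - t ^+ 2) ^+ 3 * (w - 6 * h * p + 4 * p ^+ 3).
  by rewrite /tilde_w /tilde_h /tilde_p; ring.
have ph : (tilde_p t p ^+ 2 <= tilde_h t p h) = (p ^+ 2 <= h).
  by rewrite -subr_ge0 hE pmulr_rge0 ?exprn_gt0 // subr_ge0.
have l_pos : 0 < 1 + t by lra.
have r_pos : 0 < 1 - t by lra.
rewrite ph hE wE sqrtrM ?sqr_ge0 // sqrtr_sqr gtr0_norm // -/sg /tilde_p.
(* Since [(1 - t^2) p - t + 1 = (1 - t) ((1 + t) p + 1)], a factor [1 - t] cancels here and in [e2];
   in [e3] and [e4] it is [1 + t]. *)
have e1 : ((1 - t ^+ 2) * sg / k <= (1 - t ^+ 2) * p - t + 1) =
    ((1 + t) * (- p + sg / k) <= 1).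
  by rewrite -[RHS](ler_pM2l r_pos); apply/idP/idP => ?; lra.
have e2 : ((1 - t ^+ 2) * p - t + 1 <= k * ((1 - t ^+ 2) * sg)) =
    (1 <= (1 + t) * (- p + k * sg)).
  by rewrite -[RHS](ler_pM2l r_pos); apply/idP/idP => ?; lra.
have e3 : ((1 - t ^+ 2) * sg / k <= - ((1 - t ^+ 2) * p - t) + 1) =
    ((1 - t) * (p + sg / k) <= 1).
  by rewrite -[RHS](ler_pM2l l_pos); apply/idP/idP => ?; lra.
have e4 : (- ((1 - t ^+ 2) * p - t) + 1 <= k * ((1 - t ^+ 2) * sg)) =
    (1 <= (1 - t) * (p + k * sg)).
  by rewrite -[RHS](ler_pM2l l_pos); apply/idP/idP => ?; lra.
rewrite e1 e2 e3 e4; split.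
  move=> [ph0 /andP[l1 l2] /andP[r1 r2] bnd].
  (* If [h = p^2], then [sg = 0] and the two lower bounds force [p] to be both negative and
     positive. *)
  have ph1 : p ^+ 2 < h.
    rewrite lt_neqAle ph0 andbT; apply/eqP => E.
    by move: l2 r2; rewrite /sg E subrr sqrtr0 mulr0; nra.
  by split => //; rewrite -(powR3half_boundZ _ _ _ _ _ u0) // subr_ge0.
move=> [ph1 [l1 l2] [r1 r2] bnd]; split; rewrite ?l1 ?l2 ?r1 ?r2 // ?(ltW ph1) //.
by rewrite powR3half_boundZ // subr_ge0 ltW.
Qed.

(** The slope hypothesis says that [nu F + ln (1 - t) + (nu - 1) ln (1 + t)] has nonnegative
    derivative. *)
Lemma log_growth (R : realType) (nu t0 t1 : R) (F p : R -> R) :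
  -1 < t0 -> t0 <= t1 -> t1 < 1 ->
  (forall t : R, t0 <= t <= t1 -> is_derive t 1 F (p t)) ->
  (forall t : R, t0 <= t <= t1 -> (1 - t)^-1 - (nu - 1) * (1 + t)^-1 <= nu * p t) ->
  nu * F t0 + ln ((1 - t0) / (1 - t1)) + (nu - 1) * ln ((1 + t0) / (1 + t1))
  <= nu * F t1.
Proof.
move=> t0l t01 t1u dF pF.
rewrite !ln_div ?posrE; try lra.
suff : nu * F t0 + ln (1 - t0) + (nu - 1) * ln (1 + t0) <=
  nu * F t1 + ln (1 - t1) + (nu - 1) * ln (1 + t1) by lra.
apply: (@is_derive_ge0_le _ (fun t => nu * F t + ln (1 - t) + (nu - 1) * ln (1 + t))
  (fun t => nu * p t - (1 - t)^-1 + (nu - 1) * (1 + t)^-1)) => // t tt; last first.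
  by have := pF _ tt; lra.
have dFt := dF _ tt; have /andP[ta tb] := tt.
have r_pos : 0 < 1 - t by lra.
have l_pos : 0 < 1 + t by lra.
have dr : is_derive t 1 (fun s : R => 1 - s) (- 1).
  by apply: is_derive_eq; rewrite /GRing.scale /=; ring.
have dl : is_derive t 1 (fun s : R => 1 + s) 1.
  by apply: is_derive_eq; rewrite /GRing.scale /=; ring.
have dlnr := @is_derive1_comp _ (@ln R) (fun s : R => 1 - s) t _ _ (is_derive1_ln r_pos) dr.
have dlnl := @is_derive1_comp _ (@ln R) (fun s : R => 1 + s) t _ _ (is_derive1_ln l_pos) dl.
rewrite /comp in dlnr dlnl.
by apply: is_derive_eq; rewrite /GRing.scale /=; ring.
Qed.

(** * From the barrier conditions to [P_set] *)

Section Barrier.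
Variables (R : realType) (n : nat) (nu : R) (C : set 'rV[R]_n) (f : 'rV[R]_n -> R).
Hypotheses (nu_ge2 : 2 <= nu) (C_compact : compact C) (C_convex : convex_set C).
Hypothesis f_C3 : C_on 3 C° f.

(** The chord is reparameterized to start at [x] with parameter 0 and to end at [1 - t0]. That end
    is a frontier point of [C], so [f] is unbounded towards it and the one-dimensional bounds
    apply. *)
Lemma barrier_chord_end x v c d t0 : barrier_conditions nu C f ->
  chord_param C x v c d -> C° x -> -1 < t0 < 1 -> x = affine_path c d t0 ->
  let sg := Num.sqrt (D2 f x d d - D1 f x d ^+ 2) in
  (1 - t0) * (D1 f x d + sg / Num.sqrt (nu - 1)) <= 1 /\
  1 <= (1 - t0) * (D1 f x d + Num.sqrt (nu - 1) * sg).
Proof.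
move=> [pos lim bnd] chord Cx t01 xE sg.
have t0u : 0 < 1 - t0 by lra.
have d0 : d != 0 by apply: chord_dir_neq0 chord.
have pathE s : affine_path x d s = affine_path c d (t0 + s).
  by rewrite xE /affine_path -addrA -scalerDl.
have Cs s : 0 <= s < 1 - t0 -> C° (affine_path x d s).
  move=> s01; rewrite pathE; apply: (chord_interior _ _ _ _ _ _ _ C_convex chord t0) => //.
    by rewrite -xE.
  lra.
have x0 : affine_path x d 0 = x by rewrite /affine_path scale0r addr0.
rewrite /sg -[in X in X /\ _]x0 -[in X in _ /\ X]x0.
apply: (@barrier_end_bounds _ nu (1 - t0) (f \o affine_path x d)
  (fun s => D1 f (affine_path x d s) d) (fun s => D2 f (affine_path x d s) d d)
  (fun s => D3 f (affine_path x d s) d d d)) => //.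
- by move=> s /Cs; apply: is_derive_path1.
- by move=> s /Cs; apply: is_derive_path2.
- by move=> s /Cs; apply: is_derive_path3.
- by move=> s /Cs /pos /(_ _ d0); rewrite subr_gt0 -expr2.
- by move=> s /Cs /bnd.
move=> M.
have end_frontier : (closure C `\` C°) (affine_path c d 1).
  split; last exact: chord_end_notin_interior chord.
  by apply: subset_closure; apply: (chord_mem _ _ _ _ _ _ _ chord); lra.
have /cvgryPgt /(_ M) near_end := lim _ end_frontier.
have path_cont : {for 1 - t0, continuous (affine_path x d)}.
  by apply: cvgD; [exact: cvg_cst | apply: cvgZr_tmp; exact: cvg_id].
have near_end' : nbhs (affine_path x d (1 - t0)) [set y | C° y -> M < f y].
  by rewrite pathE addrC subrK; exact: near_end.
have := path_cont _ near_end'.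
move=> /(exists_left_near _ _ _ _ t0u)[s s01 Ms].
by exists s => //; apply: Ms; apply: Cs.
Qed.

Lemma chord_P_set x v c d t0 :
  chord_param C x v c d -> C° x -> -1 < t0 < 1 -> x = affine_path c d t0 ->
  let f_I := f \o affine_path c d in
  let p := f_I^`()%classic t0 in
  let h := f_I^`(2)%classic t0 in
  let w := f_I^`(3)%classic t0 in
  let q := D1 f x d in
  let sg := Num.sqrt (D2 f x d d - q ^+ 2) in
  P_set nu (tilde_p t0 p, tilde_h t0 p h, tilde_w t0 p h w) <->
  [/\ q ^+ 2 < D2 f x d d,
      (1 + t0) * (- q + sg / Num.sqrt (nu - 1)) <= 1 /\
        1 <= (1 + t0) * (- q + Num.sqrt (nu - 1) * sg),
      (1 - t0) * (q + sg / Num.sqrt (nu - 1)) <= 1 /\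
        1 <= (1 - t0) * (q + Num.sqrt (nu - 1) * sg)
    & `|D3 f x d d d - 6 * D2 f x d d * q + 4 * q ^+ 3|
        <= 2 * barrier_gamma nu * (D2 f x d d - q ^+ 2) `^ (3 / 2)].
Proof.
move=> chord Cx t01 xE f_I p h w q sg.
have Ct0 : C° (affine_path c d t0) by rewrite -xE.
rewrite /p /h /w /f_I (derive1_path _ _ _ _ f_C3) // (derive1n2_path _ _ _ _ f_C3) //.
rewrite (derive1n3_path _ _ _ _ f_C3) // -xE.
exact: P_set_tilde.
Qed.

Lemma barrier_P_set x v c d t0 : barrier_conditions nu C f ->
  chord_param C x v c d -> C° x -> -1 < t0 < 1 -> x = affine_path c d t0 ->
  let f_I := f \o affine_path c d in
  let p := f_I^`()%classic t0 in
  let h := f_I^`(2)%classic t0 in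
  let w := f_I^`(3)%classic t0 in
  P_set nu (tilde_p t0 p, tilde_h t0 p h, tilde_w t0 p h w).
Proof.
move=> bc chord Cx t01 xE; apply/(chord_P_set _ _ _ _ _ chord Cx t01 xE).
have [pos _ bnd] := bc.
split; last 2 first.
- exact: barrier_chord_end chord Cx t01 xE.
- exact: bnd.
- by have := pos _ Cx _ (chord_dir_neq0 _ _ _ _ _ _ _ chord); rewrite subr_gt0 -expr2.
(* The bounds at the other end come from the reversed chord, where the first differential changes
   sign and the second does not. *)
- have revE : x = affine_path c (- d) (- t0) by rewrite /affine_path scalerN scaleNr opprK.
  have Nt01 : -1 < - t0 < 1 by lra.
  have := barrier_chord_end _ _ _ _ _ bc (chord_rev _ _ _ _ _ _ _ chord) Cx Nt01 revE.
  by rewrite -scaleN1r D1Z (D2Z _ _ _ _ f_C3) // sqrrN expr1n mul1r mulN1r sqrrN opprK => -[].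
Qed.

(** * From [P_set] to the barrier conditions *)

Section FromChords.
Hypothesis chord_cond : forall x v : 'rV[R]_n, C° x -> v != 0 ->
  forall (c d : 'rV[R]_n) (t0 : R),
    chord_param C x v c d -> t0 \in `]-1, 1[ -> x = affine_path c d t0 ->
    let f_I : R -> R := fun t => f (affine_path c d t) in
    let p := (f_I^`())%classic t0 in
    let h := (f_I^`(2))%classic t0 in
    let w := (f_I^`(3))%classic t0 in
    P_set nu (tilde_p t0 p, tilde_h t0 p h, tilde_w t0 p h w).

Lemma chord_bounds x v c d t0 : v != 0 ->
  chord_param C x v c d -> C° x -> -1 < t0 < 1 -> x = affine_path c d t0 ->
  let q := D1 f x d in
  let sg := Num.sqrt (D2 f x d d - q ^+ 2) in
  [/\ q ^+ 2 < D2 f x d d,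
      (1 + t0) * (- q + sg / Num.sqrt (nu - 1)) <= 1 /\
        1 <= (1 + t0) * (- q + Num.sqrt (nu - 1) * sg),
      (1 - t0) * (q + sg / Num.sqrt (nu - 1)) <= 1 /\
        1 <= (1 - t0) * (q + Num.sqrt (nu - 1) * sg)
    & `|D3 f x d d d - 6 * D2 f x d d * q + 4 * q ^+ 3|
        <= 2 * barrier_gamma nu * (D2 f x d d - q ^+ 2) `^ (3 / 2)].
Proof.
move=> v0 chord Cx t01 xE q sg; apply/(chord_P_set _ _ _ _ _ chord Cx t01 xE).
by apply: (chord_cond _ _ Cx v0) => //; rewrite in_itv.
Qed.

(** The inequalities hold for the chord direction [k v]; by homogeneity a power of [k > 0] cancels
    from each. *)
Lemma chord_barrier_pointwise x v : C° x -> v != 0 ->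
  0 < D2 f x v v - D1 f x v ^+ 2 /\
  `|D3 f x v v v - 6 * D2 f x v v * D1 f x v + 4 * D1 f x v ^+ 3|
    <= 2 * barrier_gamma nu * (D2 f x v v - D1 f x v ^+ 2) `^ (3 / 2).
Proof.
move=> Cx v0.
have [c [t0 [k [k0 t01 chord xE]]]] := chord_param_exists _ _ _ _ _ C_compact C_convex Cx v0.
have [] := chord_bounds _ _ _ _ _ v0 chord Cx t01 xE.
rewrite D1Z (D2Z _ _ _ _ f_C3) // (D3Z _ _ _ _ f_C3) //.
move: (D1 f x v) (D2 f x v v) (D3 f x v v v) => q h w pos _ _.
have {}pos : 0 < h - q ^+ 2.
  by move: pos; rewrite exprMn ltr_pM2l ?exprn_gt0 // subr_gt0.
have -> : k ^+ 3 * w - 6 * (k ^+ 2 * h) * (k * q) + 4 * (k * q) ^+ 3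
    = k ^+ 3 * (w - 6 * h * q + 4 * q ^+ 3) by ring.
by rewrite exprMn -mulrBr (powR3half_boundZ _ _ _ _ _ k0) ?(ltW pos).
Qed.

(** Eliminates [sg] between the upper bound at the end [-1], multiplied by [k^2 = nu - 1], and the
    lower bound at the end [1]. *)
Lemma chord_slope x v c d t0 : v != 0 ->
  chord_param C x v c d -> C° x -> -1 < t0 < 1 -> x = affine_path c d t0 ->
  (1 - t0)^-1 - (nu - 1) * (1 + t0)^-1 <= nu * D1 f x d.
Proof.
move=> v0 chord Cx t01 xE.
have [_ [l1 _] [_ r2] _] := chord_bounds _ _ _ _ _ v0 chord Cx t01 xE.
set sg := Num.sqrt _ in l1 r2; set q := D1 f x d in l1 r2 *.
set k := Num.sqrt (nu - 1) in l1 r2.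
have nu1 : 0 < nu - 1 by have := nu_ge2; lra.
have k0 : 0 < k by rewrite sqrtr_gt0.
have k2 : k ^+ 2 = nu - 1 by rewrite sqr_sqrtr // ltW.
have {l1} l1 : - q + sg / k <= (1 + t0)^-1.
  by rewrite -[leRHS]mul1r ler_pdivlMr; lra.
have {r2} r2 : (1 - t0)^-1 <= q + k * sg.
  by rewrite -[leLHS]mul1r ler_pdivrMr; lra.
have : k ^+ 2 * (- q + sg / k) <= k ^+ 2 * (1 + t0)^-1.
  by rewrite ler_pM2l // exprn_gt0.
have -> : k ^+ 2 * (- q + sg / k) = k * sg - (nu - 1) * q by rewrite -k2; field; lra.
rewrite k2; lra.
Qed.

(* On the chord through [x0] and [x], [(1 - t1) / (1 - t0) * r] is the radius of a ball
   around [x] contained in [C], hence bounded by the distance from [x] to [z]. *)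
Lemma chord_growth x0 x z r M : ball x0 r `<=` C -> 0 < r ->
  (forall y, C y -> `|y| <= M) -> C° x -> ~ C° z -> `|x - z| < r ->
  nu * f x0 + ln (r / `|x - z|) + (nu - 1) * ln (r / (4 * M)) <= nu * f x.
Proof.
move=> x0r r0 CM Cx Cz xz.
have Cx0 : C° x0 by apply/nbhs_ballP; exists r.
have nu2 := nu_ge2.
have ball_int y s : ball y s `<=` C -> `|y - z| < s -> C° z.
  move=> ys yz; apply/nbhs_ballP; exists (s - `|y - z|); first by rewrite /= subr_gt0.
  move=> u; rewrite -ball_normE /= => zu; apply: ys; rewrite -ball_normE /=.
  by rewrite -(subrKA z) (le_lt_trans (ler_normD _ _)) // addrC -ltrBrDr.
have xz0 : 0 < `|x - z|.
  by rewrite normr_gt0 subr_eq0; apply/eqP => xz0; apply: Cz; rewrite -xz0.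
have v0 : x - x0 != 0.
  by rewrite subr_eq0; apply/eqP => xx0; apply: Cz; apply: ball_int x0r _; rewrite -xx0.
have [c [t0 [k [k0 /andP[t0l t0u] chord x0E]]]] :=
  chord_param_exists _ _ _ _ _ C_compact C_convex Cx0 v0.
have t01 : -1 < t0 < 1 by rewrite t0l.
set d := k *: (x - x0) in chord x0E.
(* As [d] is [k] times [x - x0], the path reaches [x] after a further time [1 / k]. *)
pose t1 := t0 + k^-1.
have xE : x = affine_path c d t1.
  rewrite /affine_path scalerDl addrA -[c + _]x0E /d scalerA mulVf ?gt_eqF //.
  by rewrite scale1r addrC subrK.
have t0t1 : t0 < t1 by rewrite ltrDl invr_gt0.
have t1u : t1 < 1.
  have /andP[_] : -1 <= t1 <= 1.
    by apply: (chord_mem_inv _ _ _ _ _ _ _ chord); rewrite -xE; apply: interior_subset.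
  rewrite le_eqVlt => /orP[/eqP t1E|//].
  by case: (chord_end_notin_interior _ _ _ _ _ _ _ chord); rewrite -t1E -xE.
(* The vector [2 d] joins the two ends of the chord, both of norm at most [M]. *)
have dM : `|d| <= M.
  have : `|d *+ 2| <= M + M.
    have -> : d *+ 2 = affine_path c d 1 - affine_path c d (-1).
      by apply/rowP => i; rewrite !mxE; ring.
    rewrite (le_trans (ler_normB _ _)) // lerD // CM //;
      apply: (chord_mem _ _ _ _ _ _ _ chord); lra.
  by rewrite normrMn -mulr2n ler_pMn2r.
have d0 : 0 < `|d| by rewrite normr_gt0; apply: (chord_dir_neq0 _ _ _ _ _ _ _ chord).
have M0 : 0 < M by apply: lt_le_trans dM.
(* Moving back from [x0] by the parameter [r / (2 M)] covers at most [r / 2], so the point reached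
   is still in the ball, hence on the chord. *)
have left_ge : r / (2 * M) <= 1 + t0.
  have : -1 <= t0 - r / (2 * M) <= 1.
    apply: (chord_mem_inv _ _ _ _ _ _ _ chord); apply: x0r; rewrite -ball_normE /= x0E.
    rewrite /affine_path opprD addrACA subrr add0r -scalerBl opprB addrC subrK normrZ.
    rewrite gtr0_norm ?divr_gt0 ?mulr_gt0 // mulrAC ltr_pdivrMr ?mulr_gt0 //.
    by rewrite ltr_pM2l //; lra.
  by move=> /andP[+ _]; lra.
have right_ge : r / `|x - z| <= (1 - t0) / (1 - t1).
  rewrite ler_pdivrMr // mulrAC ler_pdivlMr ?subr_gt0 //.
  rewrite leNgt; apply/negP => xz_lt; apply: Cz.
  pose l := (1 - t1) / (1 - t0).
  apply: (ball_int x (l * r)); last first.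
    rewrite /l mulrAC ltr_pdivlMr; lra.
  have -> : x = l *: x0 + (1 - l) *: affine_path c d 1.
    by rewrite xE x0E; apply/rowP => i; rewrite !mxE /l; field; lra.
  apply: convex_ball_comb => //; first by apply: (chord_mem _ _ _ _ _ _ _ chord); lra.
  by rewrite divr_gt0 ?ler_pdivrMr ?mul1r; lra.
have path_int t : t0 <= t <= t1 -> C° (affine_path c d t).
  move=> t0t; apply: (chord_interior _ _ _ _ _ _ _ C_convex chord t0) => //.
    by rewrite -x0E.
  lra.
have slope t : t0 <= t <= t1 ->
    (1 - t)^-1 - (nu - 1) * (1 + t)^-1 <= nu * D1 f (affine_path c d t) d.
  move=> t0t; have Ct := path_int _ t0t.
  apply: (chord_slope _ _ _ _ _ v0 _ Ct) => //; last lra.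
  (* A chord through [x0] is also the chord through each of its points, since the line is the
     same. *)
  have -> : affine_path c d t = x0 + ((t - t0) * k) *: (x - x0).
    by rewrite -scalerA -/d [X in X + _]x0E /affine_path scalerBl -addrA [t0 *: d + _]addrC subrK.
  by rewrite /chord_param line_shift.
have dF t (t0t : t0 <= t <= t1) := is_derive_path1 _ _ _ _ f_C3 c d t (path_int _ t0t).
have := log_growth _ nu _ _ _ _ t0l (ltW t0t1) t1u dF slope.
rewrite /= -x0E -xE; apply: le_trans; rewrite lerD ?lerD ?ler_pM2l //; try lra.
  by rewrite ler_ln // posrE divr_gt0 //; lra.
rewrite ler_ln ?posrE ?divr_gt0 ?mulr_gt0 //; try lra.
rewrite ler_pdivlMr; last lra.
(* The factor [(1 + t1) / 2] is below 1, which accounts for [4 M] in place of [2 M]. *)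
rewrite (_ : r / (4 * M) * (1 + t1) = r / (2 * M) * ((1 + t1) / 2)); last by field; lra.
have : 0 < r / (2 * M) by rewrite divr_gt0 ?mulr_gt0.
nra.
Qed.

(** With [x0], [r] and the bound on [C] fixed, the only term of the growth estimate that varies with
    [x] is [ln (r / |x - z|)], which tends to infinity as [x] approaches [z]. *)
Lemma chord_limit z : (closure C `\` C°) z -> f @ within C° (nbhs z) --> +oo.
Proof.
move=> [_ Cz]; apply/cvgryPge => A.
(* If the interior is empty, the limit is vacuous. *)
have [[x0 Cx0]|C0] := pselect (exists x, C° x); last first.
  by near=> x; exfalso; apply: C0; exists x; near: x; exact: withinT.
have [M [_ CM]] := compact_bounded C_compact.
have M1 : M < `|M| + 1 by rewrite (le_lt_trans (ler_norm _)) // ltrDl.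
have {}CM y : C y -> `|y| <= `|M| + 1 by apply: CM.
have /nbhs_ballP [r /= r0 x0r] := Cx0.
(* [K] is the size of the logarithm that forces [nu f x >= nu A]; it is reached once [|x - z|] is
   below [r / exp K]. *)
pose K := nu * A - nu * f x0 - (nu - 1) * ln (r / (4 * (`|M| + 1))).
apply/nbhs_ballP; exists (Num.min r (r / expR K)).
  by rewrite /= lt_min r0 divr_gt0 ?expR_gt0.
move=> x; rewrite -ball_normE /= lt_min distrC => /andP[xz_r xz_K] Cx.
have xz0 : 0 < `|x - z|.
  by rewrite normr_gt0 subr_eq0; apply/eqP => xz0; apply: Cz; rewrite -xz0.
have := chord_growth _ _ _ _ _ x0r r0 CM Cx Cz xz_r.
have : K <= ln (r / `|x - z|).
  rewrite -ler_expR lnK ?posrE ?divr_gt0 // ler_pdivlMr // mulrC -ler_pdivlMr ?expR_gt0 //.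
  exact: ltW.
have nu0 : 0 < nu by have := nu_ge2; lra.
rewrite -[A <= f x](ler_pM2l nu0) /K; lra.
Unshelve. all: by end_near. Qed.

End FromChords.
End Barrier.

Theorem theorem1 (R : realType) (n : nat) (nu : R) (C : set 'rV[R]_n)
    (f : 'rV[R]_n -> R)
    (nu_ge2 : 2 <= nu) (C_compact : compact C) (C_convex : convex_set C)
    (f_C3 : C_on 3 C° f) :
  (forall x v : 'rV[R]_n, C° x -> v != 0 ->
   forall (c d : 'rV[R]_n) (t0 : R),
     chord_param C x v c d -> t0 \in `]-1, 1[ -> x = affine_path c d t0 ->
     let f_I : R -> R := fun t => f (affine_path c d t) in
     let p := (f_I^`())%classic t0 in
     let h := (f_I^`(2))%classic t0 in
     let w := (f_I^`(3))%classic t0 in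
     P_set nu (tilde_p t0 p, tilde_h t0 p h, tilde_w t0 p h w))
  <->
  barrier_conditions nu C f.
Proof.
split=> [chord_cond | bc x v Cx v0 c d t0 chord t01 xE]; last first.
  rewrite in_itv in t01.
  exact: (barrier_P_set _ _ _ _ _ nu_ge2 C_convex f_C3 _ _ _ _ _ bc chord Cx t01 xE).
have ptw := chord_barrier_pointwise _ _ _ _ _ nu_ge2 C_compact C_convex f_C3 chord_cond.
split=> [x Cx v v0 | z Cz | x Cx v].
- by rewrite -expr2; case: (ptw x v Cx v0).
- exact: (chord_limit _ _ _ _ _ nu_ge2 C_compact C_convex f_C3 chord_cond _ Cz).
(* The third condition also covers [v = 0], through which no chord is defined; there the left side
   vanishes and the right side is nonnegative. *)
- have [->|v0] := eqVneq v 0; last by case: (ptw x v Cx v0).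
  have -> : D1 f x 0 = 0 by rewrite /D1 linear0.
  have -> : D2 f x 0 0 = 0 by rewrite /D2 linear0.
  have -> : D3 f x 0 0 0 = 0 by rewrite /D3 linear0.
  rewrite !mulr0 subrr expr0n /= mulr0 addr0 normr0.
  by rewrite !mulr_ge0 ?powR_ge0 // ?divr_ge0 ?sqrtr_ge0; lra.
Qed.
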